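(* Let $q$ be a prime power, let $d$ be a positive integer, let $F(x)=x^d$ be a power function over $\mathbb{F}_q$, and let $c\in\mathbb{F}_q$ with $c\neq 1$. Let ${}_c\Delta_F$ be the $c$-differential uniformity of $F$ and, for $0\le i\le {}_c\Delta_F$, let ${}_c\omega_i=\#\{b\in\mathbb{F}_q : {}_c\delta_F(1,b)=i\}$. Then $$\sum_{i=0}^{{}_c\Delta_F}{}_c\omega_i=\sum_{i=0}^{{}_c\Delta_F} i\cdot {}_c\omega_i=q.$$ Moreover, $$\sum_{i=0}^{{}_c\Delta_F} i^2\cdot {}_c\omega_i=\frac{{}_cN_4-1}{q-1}-\gcd(d,q-1),$$ where $${}_cN_4=\#\left\{(x_1,x_2,x_3,x_4)\in(\mathbb{F}_q)^4 : x_1-x_2+x_3-x_4=0 \text{ and } x_1^d-cx_2^d+cx_3^d-x_4^d=0\right\}.$$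
   Context: For a function $F:\mathbb{F}_q\to\mathbb{F}_q$ and $a,b,c\in\mathbb{F}_q$, define ${}_c\delta_F(a,b)=\#\{x\in\mathbb{F}_q : F(x+a)-cF(x)=b\}$. The $c$-differential uniformity of $F$ is ${}_c\Delta_F=\max\{{}_c\delta_F(a,b) : a,b\in\mathbb{F}_q,\ \text{and } a\neq 0 \text{ if } c=1\}$. *)

(* Defs.v *)
From mathcomp Require Import all_boot all_order all_algebra.

Set Implicit Arguments.
Unset Strict Implicit.
Unset Printing Implicit Defensive.

Import GRing.Theory.
Local Open Scope ring_scope.

Definition cdelta (K : finFieldType) (F : K -> K) (c a b : K) : nat :=
  #|[set x : K | F (x + a) - c * F x == b]|.

(* The value 0 of the empty maximum plays no role: (1, 0) is always admissible. *)
Definition cuniformity (K : finFieldType) (F : K -> K) (c : K) : nat :=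
  \max_(ab : K * K | (c == 1) ==> (ab.1 != 0)) cdelta F c ab.1 ab.2.

Definition comega (K : finFieldType) (F : K -> K) (c : K) (i : nat) : nat :=
  #|[set b : K | cdelta F c 1 b == i]|.

Definition cN4 (K : finFieldType) (d : nat) (c : K) : nat :=
  #|[set x : K * K * K * K | let: (x1, x2, x3, x4) := x in
      (x1 - x2 + x3 - x4 == 0) &&
      (x1 ^+ d - c * x2 ^+ d + c * x3 ^+ d - x4 ^+ d == 0)]|.

(* Main.v *)
Require Import Defs.
From mathcomp Require Import all_boot all_order all_algebra cyclic finfield.

Set Implicit Arguments.
Unset Strict Implicit.
Unset Printing Implicit Defensive.

Import GRing.Theory.
Local Open Scope ring_scope.

(** Substituting x1 = x2 + a and x4 = x3 + a turns N4 into the sum over a of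
    the number of collisions of x |-> (x + a)^d - c x^d. For a != 0 the
    rescaling x |-> a x shows that all these numbers equal the one for a = 1,
    which is the sum of the squares of the fibre sizes; for a = 0, since
    c != 1, one counts the pairs with x^d = y^d, and there are
    1 + (q - 1) gcd(d, q - 1) of them. *)

Definition collisions (T : finType) (S : eqType) (f : T -> S) : nat :=
  #|[set p : T * T | f p.1 == f p.2]|.

Lemma collisionsE (T : finType) (S : eqType) (f : T -> S) :
  collisions f = (\sum_x #|[set y | f y == f x]|)%N.
Proof.
rewrite /collisions -sum1_card.
rewrite (eq_bigr (fun x => \sum_(y in [set y | f y == f x]) 1)%N); last first.
  by move=> x _; rewrite sum1_card.
rewrite pair_big_dep /=; apply: eq_bigl => -[x y] /=.
by rewrite !inE eq_sym.
Qed.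

Lemma collisions_fibers (T S : finType) (f : T -> S) :
  collisions f = (\sum_b #|[set x | f x == b]| ^ 2)%N.
Proof.
rewrite collisionsE (partition_big f predT) //=; apply: eq_bigr => b _.
rewrite (eq_bigr (fun=> #|[set x | f x == b]|)); last by move=> x /eqP->.
by rewrite sum_nat_const -mulnn; congr (_ * _)%N; apply: eq_card => x; rewrite !inE.
Qed.

(** Only the relation of having equal images matters, not the values, so a permutation [h] of the
    domain that carries one relation to the other preserves the count. *)
Lemma eq_collisions (T : finType) (S S' : eqType) (f : T -> S) (g : T -> S')
    (h : T -> T) :
  bijective h -> (forall x y, (f (h x) == f (h y)) = (g x == g y)) ->
  collisions f = collisions g.
Proof.
move=> bij_h fg; rewrite !collisionsE (reindex h) /=; last exact: onW_bij.
apply: eq_bigr => x _; rewrite -[RHS](card_imset _ (bij_inj bij_h)).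
case: (bij_h) => h' hK h'K; apply: eq_card => y.
rewrite -[y]h'K (mem_imset _ _ (bij_inj bij_h)) !inE; exact: fg.
Qed.

Lemma sum_card_fibers (T : finType) (g : T -> nat) (f : nat -> nat) (D : nat) :
  (forall b, g b <= D)%N ->
  (\sum_(0 <= i < D.+1) f i * #|[set b | g b == i]| = \sum_b f (g b))%N.
Proof.
move=> gD; rewrite big_mkord.
(* The bound [gD] keeps [inord] from collapsing values of [g] to its default. *)
rewrite (partition_big (fun b => inord (g b) : 'I_D.+1) predT) //=.
apply: eq_bigr => i _; rewrite mulnC -sum_nat_const.
apply: eq_big => [b | b]; first by rewrite inE -val_eqE /= inordK // ltnS.
by rewrite inE => /eqP->.
Qed.

(** The multiplicative group is cyclic of order [n]; the roots are the powers of an element [u] of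
    order [g], since z^d = 1 and z^n = 1 together force z^g = 1. *)
Lemma card_unity_roots (K : finFieldType) (d : nat) : (0 < d)%N ->
  #|[set z : K | z ^+ d == 1]| = gcdn d #|K|.-1.
Proof.
move=> d_gt0; set n := #|K|.-1; set g := gcdn d n.
have n_gt0 : (0 < n)%N by rewrite /n -subn1 subn_gt0 finNzRing_gt1.
have nz_expn (z : K) : z != 0 -> z ^+ n = 1.
  move=> z0; apply: (mulfI z0); rewrite -exprS mulr1 prednK ?expf_card //.
  by rewrite ltnW // finNzRing_gt1.
have [w prim_w] : exists w : K, n.-primitive_root w.
  (* The nonzero elements are [n] distinct [n]-th roots of unity, so one of them is primitive. *)
  have /hasP[w _ ?] : has n.-primitive_root (enum (predC1 (0 : K))).
    apply: has_prim_root; rewrite ?enum_uniq //.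
      by apply/allP => z; rewrite mem_enum unity_rootE => /nz_expn->.
    by rewrite -cardE cardC1.
  by exists w.
have g_n : (g %| n)%N by apply: dvdn_gcdr.
have prim_u := dvdn_prim_root prim_w g_n.
set u := w ^+ _ in prim_u.
have inj_u : injective (fun i : 'I_g => u ^+ i).
  move=> i j /eqP; rewrite (eq_prim_root_expr prim_u) !modn_small //.
  by move/eqP/val_inj.
rewrite -[RHS]card_ord -(card_imset predT inj_u); apply: eq_card => z.
rewrite inE; apply/eqP/imsetP => [zd | [i _ ->]]; last first.
  by rewrite exprAC (expr_dvd (prim_expr_order prim_u)) ?expr1n ?dvdn_gcdl.
have z0 : z != 0.
  by apply: contra_eq_neq zd => ->; rewrite expr0n eqn0Ngt d_gt0 eq_sym oner_eq0.
suff /(prim_rootP prim_u)[i ->] : z ^+ g = 1 by exists i.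
(* Bezout with natural coefficients: k d = l n + g, so no negative exponent appears. *)
have [k l kl _] := egcdnP n d_gt0.
have : z ^+ (k * d) = 1 by rewrite mulnC exprM zd expr1n.
by rewrite kl exprD mulnC exprM nz_expn // expr1n mul1r.
Qed.

(** The fibre through 0 is a singleton; the fibre through a nonzero x is the coset of x modulo the
    [d]-th roots of unity. *)
Lemma collisions_expr (K : finFieldType) (d : nat) : (0 < d)%N ->
  collisions (fun x : K => x ^+ d) = (1 + #|K|.-1 * gcdn d #|K|.-1)%N.
Proof.
move=> d_gt0; rewrite collisionsE (bigD1 0) //=; congr (_ + _)%N.
  rewrite -(cards1 (0 : K)); apply: eq_card => y.
  by rewrite !inE expr0n eqn0Ngt d_gt0 expf_eq0 d_gt0.
rewrite (eq_bigr (fun=> gcdn d #|K|.-1)); last first.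
  move=> x x0; rewrite -card_unity_roots // -[RHS](card_imset _ (mulfI x0)).
  apply: eq_card => y; rewrite -[y](mulVKf x0) (mem_imset _ _ (mulfI x0)) !inE.
  by rewrite exprMn -[X in _ == X]mulr1 (inj_eq (mulfI _)) // expf_neq0.
by rewrite sum_nat_const cardC1.
Qed.

Lemma collisions_scale (K : finFieldType) (d : nat) (c a : K) : a != 0 ->
  collisions (fun x => (x + a) ^+ d - c * x ^+ d) =
  collisions (fun x => (x + 1) ^+ d - c * x ^+ d).
Proof.
move=> a0; apply: (@eq_collisions _ _ _ _ _ ( *%R a)).
  by exists ( *%R a^-1); [apply: mulKf | apply: mulVKf].
have scale x : (a * x + a) ^+ d - c * (a * x) ^+ d =
               a ^+ d * ((x + 1) ^+ d - c * x ^+ d).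
  have -> : a * x + a = a * (x + 1) by rewrite mulrDr mulr1.
  by rewrite !exprMn mulrBr mulrCA.
by move=> x y; rewrite !scale (inj_eq (mulfI _)) // expf_neq0.
Qed.

Lemma cN4_collisions (K : finFieldType) (d : nat) (c : K) :
  cN4 d c = (\sum_(a : K) collisions (fun x : K => (x + a) ^+ d - c * x ^+ d)%R)%N.
Proof.
rewrite /collisions.
under eq_bigr => a _.
  rewrite -sum1_card (eq_bigl (fun p : K * K =>
    (p.1 + a) ^+ d - c * p.1 ^+ d == (p.2 + a) ^+ d - c * p.2 ^+ d));
    last by move=> p; rewrite inE.
  over.
rewrite pair_big_dep /= sum1_card.
(* The linear equation says x1 - x2 = x4 - x3; this common difference is a, and the free coordinates
   are x2 and x3. *)
pose h (t : K * (K * K)) := (t.2.1 + t.1, t.2.1, t.2.2, t.2.2 + t.1).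
have inj_h : injective h.
  by move=> [a [x y]] [a' [x' y']] [] exa ex -> _; move: exa; rewrite ex => /addrI->.
rewrite /cN4 -(card_imset _ inj_h); apply: eq_card => -[[[x1 x2] x3] x4].
rewrite inE; apply/andP/imsetP => [[/eqP e1 e2] | [[a [x y]]]].
  have e4 : x3 + (x1 - x2) = x4.
    by apply/eqP; rewrite -subr_eq0 [x3 + _]addrC e1.
  exists (x1 - x2, (x2, x3)); last by rewrite /h /= e4 addrC subrK.
  by apply/eqP; rewrite /= e4 [x2 + _]addrC subrK; apply/eqP; rewrite -subr_eq0 opprB addrA.
move=> /eqP /= exy [-> -> -> ->]; split.
  by rewrite [x + a]addrC addrK [a + y]addrC subrr.
by move/eqP: exy; rewrite -subr_eq0 opprB addrA.
Qed.

Lemma cN4E (K : finFieldType) (d : nat) (c : K) : (0 < d)%N -> c != 1 ->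
  cN4 d c = (1 + #|K|.-1 * gcdn d #|K|.-1 +
    #|K|.-1 * \sum_b cdelta (fun x : K => x ^+ d)%R c 1%R b ^ 2)%N.
Proof.
move=> d_gt0 c1; rewrite cN4_collisions (bigD1 0) //=; congr (_ + _)%N.
  rewrite -collisions_expr //.
  apply: (@eq_collisions _ _ _ _ _ id); first by exists id.
  (* At a = 0 the function is (1 - c) x^d, and the factor 1 - c cancels because c differs from 1. *)
  move=> x y; rewrite !addr0 -[x ^+ d in LHS]mul1r -[y ^+ d in LHS]mul1r.
  by rewrite !mulrA !mulr1 -!mulrBl (inj_eq (mulfI _)) // subr_eq0 eq_sym.
rewrite (eq_bigr _ (fun a => @collisions_scale K d c a)) sum_nat_const cardC1.
by rewrite collisions_fibers.
Qed.

(** This ensures that sums over i up to the uniformity miss no fibre size for the shift 1. *)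
Lemma cdelta_le_uniformity (K : finFieldType) (F : K -> K) (c b : K) :
  (cdelta F c 1%R b <= cuniformity F c)%N.
Proof.
by apply: (leq_bigmax_cond (1, b)); rewrite /= oner_eq0 implybT.
Qed.

Lemma sum_cdelta (K : finFieldType) (F : K -> K) (c a : K) :
  (\sum_b cdelta F c a b = #|K|)%N.
Proof.
rewrite -sum1_card [RHS](partition_big (fun x => F (x + a) - c * F x) predT) //=.
by apply: eq_bigr => b _; rewrite sum1dep_card.
Qed.

Theorem theorem4 (K : finFieldType) (q : nat) (Kq : #|K| = q)
    (d : nat) (d_gt0 : (0 < d)%N) (c : K) (c_neq1 : c <> 1) :
  let F := fun x : K => x ^+ d in
  let D := cuniformity F c in
  let omega := comega F c in
  [/\ (\sum_(0 <= i < D.+1) omega i = \sum_(0 <= i < D.+1) i * omega i)%N,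
      (\sum_(0 <= i < D.+1) i * omega i = q)%N
    & \sum_(0 <= i < D.+1) i%:R ^+ 2 * (omega i)%:R
      = ((cN4 d c)%:R - 1) / (q%:R - 1) - (gcdn d (q - 1)%N)%:R :> rat].
Proof.
move=> F D omega.
(* All three sums are instances, with f constant 1, the identity and the square. *)
have sum_omega f : (\sum_(0 <= i < D.+1) f i * omega i =
                    \sum_b f (cdelta F c 1%R b))%N.
  by apply: sum_card_fibers => b; apply: cdelta_le_uniformity.
have moment1 : (\sum_(0 <= i < D.+1) i * omega i = q)%N.
  by rewrite (sum_omega id) sum_cdelta.
split=> //.
  rewrite moment1 -Kq -sum1_card -(sum_omega (fun=> 1%N)).
  by apply: eq_bigr => i _; rewrite mul1n.
have -> : \sum_(0 <= i < D.+1) i%:R ^+ 2 * (omega i)%:R =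
          (\sum_b cdelta F c 1%R b ^ 2)%N%:R :> rat.
  rewrite -(sum_omega (fun i => i ^ 2)%N) natr_sum.
  by apply: eq_bigr => i _; rewrite natrM natrX.
have q_gt1 : (1 < q)%N by rewrite -Kq finNzRing_gt1.
rewrite cN4E //; last exact/eqP.
(* As q > 1, the truncated q - 1 agrees with the rational one, and it is nonzero, so it can be
   divided out of N4 - 1. *)
rewrite Kq -subn1 -(natrB _ (ltnW q_gt1)) !natrD !natrM.
have nz : (q - 1)%:R != 0 :> rat by rewrite Num.Theory.pnatr_eq0 -lt0n subn_gt0.
by rewrite -[1%:R + _ + _]addrA -mulrDr [1%:R + _]addrC addrK mulrC mulKf // addrC addKr.
Qed.
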